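(* Let $(X_i)_{i\in I}$ be a family of topological spaces. If $X_i$ is h-homogeneous and zero-dimensional for every $i\in I$, then the product $\prod_{i\in I}X_i$ is h-homogeneous.
   Context: All spaces are assumed to be Tychonoff (completely regular Hausdorff). Products carry the product topology. A subset of a space is clopen if it is closed and open. A space is zero-dimensional if it has a base consisting of clopen sets. A space $X$ is h-homogeneous if all non-empty clopen subsets of $X$ (with the subspace topology) are homeomorphic to each other. *)

(* Defs.v *)
From HB Require Import structures.
From mathcomp Require Import all_boot all_order all_algebra.
From mathcomp Require Import all_classical all_reals all_analysis.

Set Implicit Arguments.
Unset Strict Implicit.
Unset Printing Implicit Defensive.

Local Open Scope classical_set_scope.

Definition tychonoff_space (T : topologicalType) : Prop :=
  hausdorff_space T /\ completely_regular_space T.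

(* This is the existence of a clopen base. It differs from the library's
   [zero_dimensional], which only asks that distinct points be separated by a
   clopen set (strictly weaker on non-compact Hausdorff spaces in general). *)
Definition zero_dimensional_space (T : topologicalType) : Prop :=
  exists2 B : set (set T), basis B & B `<=` clopen.

Definition homeomorphic (T U : topologicalType) : Prop :=
  exists (f : T -> U) (g : U -> T),
    [/\ cancel f g, cancel g f, continuous f & continuous g].

(* [set_type A] carries the subspace topology; [subspace A] would not do, since
   its carrier is the whole of [T]. *)
Definition h_homogeneous (T : topologicalType) : Prop :=
  forall A B : set T, clopen A -> clopen B -> A !=set0 -> B !=set0 ->
    homeomorphic (set_type A) (set_type B).

(* Main.v *)
(* Let P be the product and C a nonempty clopen subset; the claim is C ~ P.
   A nonempty clopen box is a product of copies of the factors, so it is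
   homeomorphic to P, and clopen boxes form a base.

   If P has a locally finite sequence of nonempty open sets (Terada's case), P
   contains a locally finite disjoint sequence of clopen copies of itself. Write
   C = E + D with E a box; each copy contains a copy P_n of D, so with R the
   complement of the union of the P_n,
     C = E + D ~ R + P_0 + P_1 + ... + D ~ R + P_0 + P_1 + ... = P
   by the shift D -> P_0 -> P_1 -> ....

   Otherwise every sequence of nonempty open sets accumulates somewhere. This
   forces C to depend on finitely many coordinates only and, for each coordinate
   i, the slices {x | x[i:=a] in C}, a in X i, to be finite in number and
   locally constant in a. Induction on the essential coordinates then splits C
   into finitely many disjoint clopen boxes; and unless P is a single point,
   P ~ P + P, so that a finite nonempty sum of copies of P is a copy of P. *)
Require Import Defs.
From mathcomp Require Import all_boot all_order all_algebra.
From mathcomp Require Import all_classical all_reals all_analysis.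

Set Implicit Arguments.
Unset Strict Implicit.
Unset Printing Implicit Defensive.

Local Open Scope classical_set_scope.

(** * Homeomorphisms between subsets, with maps defined on the ambient spaces *)

(* [f] and [g] are total and continuous in the ambient spaces at the points of
   [A] and [B], which for open [A] and [B] is continuity for the subspace
   topologies; this lets functions on disjoint open sets be glued. *)
Definition embeds (T U : topologicalType) (A : set T) (B : set U)
    (f : T -> U) (g : U -> T) :=
  forall x, A x -> [/\ B (f x), g (f x) = x & {for x, continuous f}].

Definition homeo_on (T U : topologicalType) (A : set T) (B : set U) f g :=
  embeds A B f g /\ embeds B A g f.

Definition homeo_sets (T U : topologicalType) (A : set T) (B : set U) :=
  exists f g, homeo_on A B f g.

Lemma homeo_sets_refl (T : topologicalType) (A : set T) : homeo_sets A A.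
Proof. by exists id, id; split=> x Ax; split=> //; exact: cvg_id. Qed.

Lemma homeo_sets_sym (T U : topologicalType) (A : set T) (B : set U) :
  homeo_sets A B -> homeo_sets B A.
Proof. by move=> [f [g [fg gf]]]; exists g, f. Qed.

Lemma embeds_comp (T U V : topologicalType) (A : set T) (B : set U) (C : set V)
    f g f' g' : embeds A B f g -> embeds B C f' g' ->
  embeds A C (f' \o f) (g \o g').
Proof.
move=> E E' x /E [Bfx gfx cf]; have [Cx g'f' cf'] := E' _ Bfx.
by split; rewrite //= ?g'f' //; exact: continuous_comp.
Qed.

Lemma homeo_sets_trans (T U V : topologicalType) (A : set T) (B : set U)
  (C : set V) : homeo_sets A B -> homeo_sets B C -> homeo_sets A C.
Proof.
move=> [f [g [fg gf]]] [f' [g' [fg' gf']]]; exists (f' \o f), (g \o g').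
by split; apply: embeds_comp; eassumption.
Qed.

Lemma homeo_on_image (T U : topologicalType) (A C : set T) (B : set U) f g :
  homeo_on A B f g -> C `<=` A -> homeo_on C (f @` C) f g.
Proof.
move=> [fg gf] CA; split=> [x Cx|_ [x Cx <-]].
  by have [_ ? ?] := fg _ (CA _ Cx); split=> //; exists x.
have [Bx gfx _] := fg _ (CA _ Cx); rewrite gfx; split=> //.
by have [] := gf _ Bx.
Qed.

(** Near [f x] the image contains every point of [B] that [g] sends into [C], and [g] is continuous
    at [f x]. *)
Lemma homeo_on_open_image (T U : topologicalType) (A C : set T) (B : set U)
    f g : homeo_on A B f g -> open B -> C `<=` A -> open C -> open (f @` C).
Proof.
move=> [fg gf]; rewrite !openE => oB CA oC _ [x Cx <-]; rewrite /interior.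
have [Bx gfx _] := fg _ (CA _ Cx); have [_ _ cg] := gf _ Bx.
have /cg gC : nbhs (g (f x)) C by rewrite gfx; exact: oC.
by apply: filterS2 (oB _ Bx) gC => y /gf[_ fgy _] Cgy; exists (g y).
Qed.

(** * Gluing over disjoint open families *)

Lemma glue_functions (T : Type) (K : Type) (A : K -> set T) (f : K -> T -> T) :
  trivIset setT A -> exists F : T -> T, forall k x, A k x -> F x = f k x.
Proof.
move=> tA; have /choice [F HF] : forall x, exists y, forall k, A k x -> y = f k x.
  move=> x; have [[k Akx]|nA] := pselect (exists k, A k x).
    exists (f k x) => l Alx; suff -> : k = l by [].
    by apply: (tA k l) => //; exists x.
  (* Off the union of the [A k] any value would do. *)
  by exists x => k Akx; case: nA; exists k.
by exists F => k x; exact: HF.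
Qed.

(** Continuity is local: [F] agrees with [f k] on [A k], which is a neighborhood of each of its
    points. *)
Lemma embeds_bigcup (T : topologicalType) (K : Type) (A B : K -> set T)
    (f g : K -> T -> T) (F G : T -> T) :
  (forall k, open (A k)) -> (forall k x, A k x -> F x = f k x) ->
  (forall k y, B k y -> G y = g k y) ->
  (forall k, embeds (A k) (B k) (f k) (g k)) ->
  embeds (\bigcup_k A k) (\bigcup_k B k) F G.
Proof.
move=> oA Ff Gg E x [k _ Akx]; have [Bkx gfx cf] := E _ _ Akx.
rewrite (Ff k x) // (Gg k) //; split=> //; first by exists k.
rewrite /prop_for/continuous_at (Ff k x) //; apply: cvg_trans cf.
apply: near_eq_cvg; have := oA k; rewrite openE => /(_ _ Akx).
by apply: filterS => y /Ff ->.
Qed.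

Lemma homeo_sets_bigcup (T : topologicalType) (K : Type) (A B : K -> set T) :
  (forall k, open (A k)) -> (forall k, open (B k)) ->
  trivIset setT A -> trivIset setT B ->
  (forall k, homeo_sets (A k) (B k)) ->
  homeo_sets (\bigcup_k A k) (\bigcup_k B k).
Proof.
move=> oA oB tA tB AB; have /choice[f /choice[g fg]] := AB.
have [F Ff] := glue_functions f tA; have [G Gg] := glue_functions g tB.
exists F, G; split.
  by apply: embeds_bigcup Ff Gg _ => // k; case: (fg k).
by apply: embeds_bigcup Gg Ff _ => // k; case: (fg k).
Qed.

(** * Comparison with homeomorphisms of subspaces *)

Lemma continuous_set_type (Z T : topologicalType) (A : set T)
  (f : Z -> set_type A) : continuous (set_val \o f) -> continuous f.
Proof. exact: continuous_comp_initial. Qed.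

Lemma embeds_continuous_set_type (T U : topologicalType) (A : set T)
    (B : set U) f g (F : set_type A -> set_type B) :
  embeds A B f g -> (forall x, val (F x) = f (val x)) -> continuous F.
Proof.
move=> fg Ff; apply: continuous_set_type => x.
rewrite [_ \o _](_ : _ = f \o set_val); last by apply/funext => y; exact: Ff.
apply: continuous_comp; first exact: initial_continuous.
by have [] := fg _ (set_valP x).
Qed.

Lemma homeo_sets_set_type (T U : topologicalType) (A : set T) (B : set U) :
  homeo_sets A B -> homeomorphic (set_type A) (set_type B).
Proof.
move=> [f [g [fg gf]]].
have Bf (x : set_type A) : f (val x) \in B.
  by apply: mem_set; have [] := fg _ (set_valP x).
have Ag (x : set_type B) : g (val x) \in A.
  by apply: mem_set; have [] := gf _ (set_valP x).
exists (fun x => SigSub (Bf x)), (fun x => SigSub (Ag x)); split.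
- by move=> x; apply: val_inj => /=; have [] := fg _ (set_valP x).
- by move=> x; apply: val_inj => /=; have [] := gf _ (set_valP x).
- exact: embeds_continuous_set_type fg _.
- exact: embeds_continuous_set_type gf _.
Qed.

(** Extension by the constant [u] off [A] does not affect continuity on [A]: as [A] is open, a
    neighborhood in the subspace is one in [T]. *)
Lemma extend_set_type (T U : topologicalType) (A : set T) (B : set U)
    (F : set_type A -> set_type B) (u : U) : open A -> continuous F ->
  exists f : T -> U, (forall x : set_type A, f (val x) = val (F x)) /\
    (forall x, A x -> {for x, continuous f}).
Proof.
move=> oA cF.
pose f x := if pselect (A x) is left Ax then val (F (SigSub (mem_set Ax))) else u.
have fF (x : set_type A) : f (val x) = val (F x).
  rewrite /f; case: pselect => [Ax|/(_ (set_valP x))//].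
  by congr (val (F _)); exact: val_inj.
exists f; split=> // x Ax V.
pose x' : set_type A := SigSub (mem_set Ax).
rewrite -[x]/(val x') fF => FV.
have : nbhs x' ((set_val \o F) @^-1` V).
  by apply: (continuous_comp (cF x') _ FV); exact: initial_continuous.
rewrite nbhsE => -[_ [[W oW <-] Wx]] WV.
rewrite nbhsE; exists (W `&` A); first by split=> //; exact: openI.
move=> y [Wy Ay] /=; rewrite -[y]/(val (SigSub (mem_set Ay) : set_type A)) fF.
exact: WV.
Qed.

Lemma set_type_homeo_sets (T U : topologicalType) (A : set T) (B : set U) :
  open A -> open B -> A !=set0 -> B !=set0 ->
  homeomorphic (set_type A) (set_type B) -> homeo_sets A B.
Proof.
move=> oA oB [a Aa] [b Bb] [F [G [FK GK cF cG]]].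
have [f [fF cf]] := extend_set_type b oA cF.
have [g [gG cg]] := extend_set_type a oB cG.
exists f, g; split=> [x Ax|y By].
  rewrite -[x]/(val (SigSub (mem_set Ax) : set_type A)) fF gG FK.
  by split=> //; [exact: set_valP|exact: cf].
rewrite -[y]/(val (SigSub (mem_set By) : set_type B)) gG fF GK.
by split=> //; [exact: set_valP|exact: cg].
Qed.

(** * Clopen boxes in a product *)

Section boxes.
Context {I : eqType} (X : I -> topologicalType).
Local Notation P := (prod_topology X).

Lemma cvg_prod_topology (F : set_system P) (l : P) : Filter F ->
  (forall i, (fun x : P => x i) @ F --> l i) -> F --> l.
Proof.
move=> FF Fl; apply/cvg_sup => i A [_ [[W oW <-] Wl]] /filterS; apply.
by apply: (Fl i); exact: open_nbhs_nbhs.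
Qed.

Lemma continuous_prod_topology (Z : topologicalType) (f : Z -> P) (z : Z) :
  (forall i, {for z, continuous (fun x => f x i)}) -> {for z, continuous f}.
Proof. by move=> cf; apply: cvg_prod_topology => i; exact: cf. Qed.

(** Joint continuity allows a neighborhood of the point and one of its new coordinate to be chosen
    together. *)
Lemma continuous_dfwith2 (i : I) :
  continuous (fun xa : P * X i => dfwith xa.1 i xa.2 : P).
Proof.
move=> [x a]; apply: continuous_prod_topology => j /=.
have [<-|ij] := eqVneq i j.
  rewrite (_ : (fun _ => _) = snd); last by apply/funext => xa; rewrite dfwithin.
  exact: cvg_snd.
rewrite (_ : (fun _ => _) = proj j \o fst); last first.
  by apply/funext => xa; rewrite dfwithout.
exact: (@continuous_comp (P * X i)%type P (X j) fst (@proj I X j) (x, a)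
  cvg_fst (@proj_continuous I X j x)).
Qed.

Definition box (U : forall i, set (X i)) : set P := [set x | forall i, U i (x i)].

(* The last condition follows from the other two; it is recorded here because
   it is immediate for cylinders and stable under intersection. *)
Definition clopen_box (U : forall i, set (X i)) :=
  [/\ forall i, clopen (U i), finite_set [set i | U i <> setT] &
      clopen (box U)].

Lemma clopen_boxT : clopen_box (fun=> setT).
Proof.
split=> [i||]; first exact: clopenT.
  by rewrite (_ : mkset _ = set0) //; apply/seteqP; split.
by rewrite (_ : box _ = setT); [exact: clopenT|apply/seteqP; split].
Qed.

Lemma boxI U V : box (fun i => U i `&` V i) = box U `&` box V.
Proof.
apply/seteqP; split=> [x UV|x [Ux Vx] i]; last by split.
by split=> i; have [] := UV i.
Qed.

Lemma clopen_boxI U V : clopen_box U -> clopen_box V ->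
  clopen_box (fun i => U i `&` V i).
Proof.
move=> [cU fU oU] [cV fV oV]; split=> [i||].
- exact: clopenI.
- apply: (@sub_finite_set _ _ ([set i | U i <> setT] `|` [set i | V i <> setT])).
    move=> i /= UV; apply: contrapT => /not_orP[/contrapT UT /contrapT VT].
    by apply: UV; rewrite UT VT setIT.
  by rewrite finite_setU.
- by rewrite boxI; exact: clopenI.
Qed.

Definition cylinder i (A : set (X i)) : forall j, set (X j) :=
  dfwith (fun=> setT) i A.

Lemma box_cylinder i (A : set (X i)) : box (cylinder A) = [set x | A (x i)].
Proof.
apply/seteqP; split=> [x /(_ i)|x /= Ax j]; rewrite /cylinder.
  by rewrite dfwithin.
by case: dfwithP.
Qed.

Lemma clopen_cylinder i (A : set (X i)) : clopen A -> clopen_box (cylinder A).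
Proof.
move=> cA; split=> [j||].
- by rewrite /cylinder; case: dfwithP => // *; exact: clopenT.
- apply: (@sub_finite_set _ _ [set i]); last exact: finite_set1.
  by move=> j /=; rewrite /cylinder; case: dfwithP.
- rewrite box_cylinder -[mkset _]/(proj i @^-1` A).
  by apply: preimage_clopen => //; exact: proj_continuous.
Qed.

Hypothesis zeroX : forall i : I, zero_dimensional_space (X i).

(** The clopen boxes around [x] generate a filter. It converges to [x] in each coordinate, because
    cylinders over clopen sets are clopen boxes, hence it converges in the product. *)
Lemma nbhs_clopen_box (x : P) O : nbhs x O ->
  exists U, [/\ clopen_box U, box U x & box U `<=` O].
Proof.
pose F : set_system P := filter_from [set U | clopen_box U /\ box U x] box.
have FF : Filter F.
  apply: filter_from_filter; first by exists (fun=> setT); split=> //; exact: clopen_boxT.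
  move=> U V [cU Ux] [cV Vx]; exists (fun i => U i `&` V i).
    by split; [exact: clopen_boxI|rewrite boxI].
  by rewrite boxI.
suff Fx : F --> x by move=> /Fx[U [cU Ux] UO]; exists U; split.
apply: cvg_prod_topology => i V xV.
have [B [_ Bx] Bc] := zeroX i; have [A /= [BA Ax] AV] := Bx _ _ xV.
exists (cylinder A); first by split; [exact/clopen_cylinder/Bc|rewrite box_cylinder].
by rewrite box_cylinder => y /AV.
Qed.

Hypothesis homX : forall i : I, h_homogeneous (X i).

(** Each [U i] is clopen and nonempty, so it is a copy of [X i]; these homeomorphisms are applied
    coordinatewise. *)
Lemma homeo_sets_box U : (forall i, clopen (U i)) -> box U !=set0 ->
  homeo_sets (box U) [set: P].
Proof.
move=> cU [x Ux].
have fgP i : {fg : (X i -> X i) * (X i -> X i) |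
    homeo_on (U i) [set: X i] fg.1 fg.2}.
  apply: cid.
  have [|||||f [g fg]] := @set_type_homeo_sets _ _ (U i) [set: X i].
  - by case: (cU i).
  - exact: openT.
  - by exists (x i); exact: Ux.
  - by exists (x i).
  - by apply: homX => //; [exact: clopenT|exists (x i); exact: Ux|exists (x i)].
  - by exists (f, g).
have coordinatewise (h : forall i, X i -> X i) (y : P) :
    (forall i, {for y i, continuous (h i)}) ->
    {for y, continuous (fun z : P => (fun i => h i (z i)) : P)}.
  move=> ch; apply: continuous_prod_topology => i.
  by apply: (continuous_comp (@proj_continuous _ X i y)); exact: ch.
exists (fun y i => (sval (fgP i)).1 (y i)), (fun y i => (sval (fgP i)).2 (y i)).
split=> y Uy; split=> //.
- apply: functional_extensionality_dep => i; have [fg _] := svalP (fgP i).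
  by have [] := fg _ (Uy i).
- apply: (coordinatewise (fun i => (sval (fgP i)).1)) => i; have [fg _] := svalP (fgP i).
  by have [] := fg _ (Uy i).
- by move=> i; have [_ /(_ (y i) Logic.I)[]] := svalP (fgP i).
- apply: functional_extensionality_dep => i.
  by have [_ /(_ (y i) Logic.I)[]] := svalP (fgP i).
- apply: (coordinatewise (fun i => (sval (fgP i)).2)) => i.
  by have [_ /(_ (y i) Logic.I)[]] := svalP (fgP i).
Qed.

End boxes.

(** * Spaces with a locally finite sequence of nonempty open sets *)

Definition locally_finite_seq (T : topologicalType) (A : nat -> set T) :=
  forall p : T, exists N, \forall q \near p, forall n, (N <= n)%N -> ~ A n q.

(** Near a point off the union only the indices below some [N] matter, and finitely many closed sets
    can be avoided at once. *)
Lemma closed_bigcup_locally_finite (T : topologicalType) (A : nat -> set T) :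
  (forall n, closed (A n)) -> locally_finite_seq A -> closed (\bigcup_n A n).
Proof.
move=> cA lA; rewrite -openC openE => p nAp.
have [N nearN] := lA p.
have : \forall q \near p, forall n : 'I_N, ~ A n q.
  apply: filter_forall => n; have := closed_openC (cA n); rewrite openE; apply.
  by move=> Anp; apply: nAp; exists n.
apply: filterS2 nearN => q qN qlt [n _ Anq].
by have [/qN|nN] := leqP N n; [exact|exact: (qlt (Ordinal nN))].
Qed.

Section terada.
Variable T : topologicalType.
Hypothesis pi_baseT : forall O : set T, open O -> O !=set0 ->
  exists2 B, clopen B & B `<=` O /\ homeo_sets B [set: T].

(** Inside each [O n] there is a clopen copy of [T] so small that it misses all late [O m]. Passing
    each time to an index from which the previous copy is missed makes the copies disjoint; local
    finiteness is inherited from [O]. *)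
Lemma locally_finite_copies (O : nat -> set T) :
  (forall n, open (O n)) -> (forall n, O n !=set0) -> locally_finite_seq O ->
  exists B : nat -> set T, [/\ forall n, clopen (B n),
    forall n, homeo_sets (B n) [set: T], trivIset setT B &
    locally_finite_seq B].
Proof.
move=> oO O0 lO.
have : forall n, exists BN : set T * nat, [/\ clopen BN.1,
    homeo_sets BN.1 [set: T], BN.1 `<=` O n, (n < BN.2)%N &
    forall m, (BN.2 <= m)%N -> BN.1 `&` O m = set0].
  move=> n; have [x Ox] := O0 n; have [N] := lO x.
  rewrite /prop_near1 nbhsE => -[V [oV Vx] VN].
  have [||B cB [BOV BT]] := @pi_baseT (O n `&` V); first exact: openI.
    by exists x.
  (* The maximum with [n.+1] makes the selected indices strictly increasing. *)
  exists (B, maxn N n.+1); split=> //=; first by move=> y /BOV[].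
    by rewrite leq_max ltnSn orbT.
  move=> m; rewrite geq_max => /andP[Nm _]; apply/seteqP; split=> // y [By Oy].
  by have [_ /VN/(_ _ Nm)] := BOV _ By.
move=> /choice[BN BNP]; pose k := fix k j := if j is i.+1 then (BN (k i)).2 else 0%N.
have kS j : (k j < k j.+1)%N by rewrite /=; have [] := BNP (k j).
have k_homo i j : (i <= j)%N -> (k i <= k j)%N.
  elim: j => [|j IH]; first by rewrite leqn0 => /eqP->.
  by rewrite leq_eqVlt => /predU1P[->//|/IH/leq_trans]; apply; exact: ltnW.
have k_ge j : (j <= k j)%N.
  by elim: j => // j IH; exact: leq_ltn_trans IH (kS j).
exists (fun j => (BN (k j)).1); split=> [j|j||p].
- by have [] := BNP (k j).
- by have [] := BNP (k j).
- apply: ltn_trivIset => n m mn; have [_ _ BO _ _] := BNP (k n).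
  have [_ _ _ _ disj] := BNP (k m); have := disj (k n) (k_homo _ _ mn).
  by move=> BO0; apply/seteqP; split=> // x [Bm /BO On]; rewrite -BO0.
- have [N nearN] := lO p; exists N; apply: filterS nearN => q qN n Nn.
  have [_ _ BO _ _] := BNP (k n) => /BO; apply: qN.
  exact: leq_trans Nn (k_ge n).
Qed.

Lemma clopen_homeo_on_image (A B C : set T) f g : homeo_on A B f g ->
  clopen A -> clopen B -> C `<=` A -> clopen C -> clopen (f @` C).
Proof.
move=> fg [oA _] [oB cB] CA [oC cC]; split; first exact: homeo_on_open_image fg _ _ _.
rewrite -openC (_ : ~` _ = ~` B `|` f @` (A `\` C)).
  apply: openU; first exact: closed_openC.
  apply: homeo_on_open_image fg oB _ _; first by move=> x [].
  by apply: openI => //; exact: closed_openC.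
have [fgA gfB] := fg; apply/seteqP; split=> [y nCy|y [nBy [x Cx xy]|]].
- have [By|nBy] := pselect (B y); [right|by left].
  have [Ay fgy _] := gfB _ By; exists (g y) => //; split=> // Cgy.
  by apply: nCy; exists (g y).
- by apply: nBy; rewrite -xy; have [] := fgA _ (CA _ Cx).
- move=> [x [Ax nCx] <-] [x' Cx' xx']; apply: nCx.
  have [_ <- _] := fgA _ Ax; have [_ gfx' _] := fgA _ (CA _ Cx').
  by rewrite -xx' gfx'.
Qed.

Lemma homeo_sets_locally_finite (O : nat -> set T) (C : set T) :
  (forall n, open (O n)) -> (forall n, O n !=set0) -> locally_finite_seq O ->
  clopen C -> C !=set0 -> homeo_sets C [set: T].
Proof.
move=> oO O0 lO cC C0; have [B [cB BT tB lB]] := locally_finite_copies oO O0 lO.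
have [E cE [EC /homeo_sets_sym[f [g fg]]]] := pi_baseT cC.1 C0.
pose D := C `\` E.
have cD : clopen D by apply: clopenI => //; exact: clopenC.
have : forall n, exists h : (T -> T) * (T -> T), homeo_on [set: T] (B n) h.1 h.2.
  by move=> n; have /homeo_sets_sym[h [h' hh']] := BT n; exists (h, h').
move=> /choice[h hP]; pose P n := (h n).1 @` D.
have cP n : clopen (P n).
  by apply: clopen_homeo_on_image (hP n) clopenT (cB n) _ cD.
have PB n : P n `<=` B n.
  by move=> _ [x _ <-]; have [/(_ x Logic.I)[]] := hP n.
have PD n : homeo_sets D (P n).
  by exists (h n).1, (h n).2; exact: homeo_on_image (hP n) _.
have tP : trivIset setT P.
  by move=> m n _ _ [x [/PB Bm /PB Bn]]; apply: tB => //; exists x.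
pose R := ~` \bigcup_n P n.
have oR : open R.
  apply: closed_openC; apply: closed_bigcup_locally_finite => [n|p].
    by have [] := cP n.
  have [N nearN] := lB p; exists N; apply: filterS nearN => q qN n Nn /PB.
  exact: qN.
(* Matching decompositions of [C] and of the space: [None] pairs [f @] R[with]R[,]Some
   0[pairs]D[with]P 0[, and]Some m.+1[pairs]f @[P m] with [P m.+1], both copies of [D]. *)
pose A (k : option nat) := if k is Some n then
  (if n is m.+1 then f @` P m else D) else f @` R.
pose A' (k : option nat) := if k is Some n then P n else R.
have ofI S : open S -> open (f @` S).
  by move=> oS; exact: homeo_on_open_image fg cE.1 _ _.
have fE x : E (f x) by have [/(_ x Logic.I)[]] := fg.
have fK x : g (f x) = x by have [/(_ x Logic.I)[]] := fg.
have gK y : E y -> f (g y) = y by have [_ gf] := fg => /gf[].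
have <- : \bigcup_k A' k = [set: T].
  apply/seteqP; split=> // x _.
  by have [[n _ Px]|nP] := pselect ((\bigcup_n P n) x); [exists (Some n)|exists None].
have <- : \bigcup_k A k = C.
  apply/seteqP; split=> [x [[[|n]|] _ /=]|x Cx]; first by case.
  - by move=> [y _ <-]; exact: EC.
  - by move=> [y _ <-]; exact: EC.
  have [Ex|nEx] := pselect (E x); last by exists (Some 0%N).
  rewrite -(gK x Ex).
  have [[n _ Px]|nP] := pselect ((\bigcup_n P n) (g x)).
    by exists (Some n.+1) => //; exists (g x).
  by exists None => //; exists (g x).
apply: homeo_sets_bigcup.
- move=> [[|n]|] /=; [by case: cD|by apply: ofI; case: (cP n)|exact: ofI].
- by move=> [n|] //=; case: (cP n).
- move=> [[|m]|] [[|n]|] _ _ [x []] //=.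
  + by move=> [_ nE] [y _ yx]; case: nE; rewrite -yx.
  + by move=> [_ nE] [y _ yx]; case: nE; rewrite -yx.
  + by move=> [y _ yx] [_ nE]; case: nE; rewrite -yx.
  + move=> [y Py yx] [z Pz]; rewrite -yx => /(congr1 g); rewrite !fK => zy.
    by rewrite (tP m n) //; exists y; split=> //; rewrite -zy.
  + move=> [y Py yx] [z Rz]; rewrite -yx => /(congr1 g); rewrite !fK => zy.
    by case: Rz; exists m => //; rewrite zy.
  + by move=> [y _ yx] [_ nE]; case: nE; rewrite -yx.
  + move=> [z Rz zx] [y Py]; rewrite -zx => /(congr1 g); rewrite !fK => zy.
    by case: Rz; exists n => //; rewrite -zy.
- move=> [m|] [n|] _ _ [x []] //=.
  + by move=> Pm Pn; rewrite (tP m n) //; exists x.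
  + by move=> Pm nP; case: nP; exists m.
  + by move=> nP Pn; case: nP; exists n.
have fP S : homeo_sets (f @` S) S.
  by apply: homeo_sets_sym; exists f, g; exact: homeo_on_image fg _.
move=> [[|n]|] //=; apply: homeo_sets_trans (fP _) _.
by apply: homeo_sets_trans (PD n.+1); apply: homeo_sets_sym.
Qed.

End terada.

(** * Clopen sets in products without such a sequence *)

Lemma infinite_set_injection (T : Type) (A : set T) : infinite_set A ->
  exists k : nat -> T, injective k /\ forall n, A (k n).
Proof.
elim/Ppointed: T => T in A *; first by rewrite emptyE => /(_ (finite_set0 _)).
move=> /infiniteP/pcard_leP/unsquash k; exists k; split=> [m n|n]; last exact: funS.
by apply: inj; rewrite inE.
Qed.

Lemma finite_nat_bounded (A : set nat) : finite_set A ->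
  exists N, forall n, A n -> (n < N)%N.
Proof.
move=> /finite_seqP[s ->]; exists (\max_(i <- s) i).+1 => n /= ns.
by rewrite ltnS; exact: leq_bigmax_seq.
Qed.

Section pseudocompact_product.
Context {I : eqType} (X : I -> topologicalType).
Local Notation P := (prod_topology X).
Hypothesis zeroX : forall i : I, zero_dimensional_space (X i).
Hypothesis not_lf : forall O : nat -> set P,
  (forall n, open (O n)) -> (forall n, O n !=set0) -> ~ locally_finite_seq O.

(** For Tychonoff spaces [not_lf] is pseudocompactness; it is used in this form. *)
Lemma accumulation_point (O : nat -> set P) :
  (forall n, open (O n)) -> (forall n, O n !=set0) ->
  exists p : P, forall V, nbhs p V ->
    forall N, exists n, (N <= n)%N /\ V `&` O n !=set0.
Proof.
move=> oO O0; apply: contrapT => nacc; apply: (not_lf oO O0) => p.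
apply: contrapT => nlf; apply: nacc; exists p => V pV N; apply: contrapT => nV.
apply: nlf; exists N; apply: filterS pV => q Vq n Nn Oq; apply: nV; exists n.
by split=> //; exists q.
Qed.

(** The accumulation point lies in [C] because [C] is closed, and has a box around it inside [C]
    because [C] is open. *)
Lemma accumulation_box (O : nat -> set P) (C : set P) : clopen C ->
  (forall n, open (O n)) -> (forall n, O n !=set0) -> (forall n, O n `<=` C) ->
  exists U, [/\ clopen_box U, box U `<=` C &
    forall N, exists n, (N <= n)%N /\ box U `&` O n !=set0].
Proof.
move=> [oC cC] oO O0 OC; have [p pacc] := accumulation_point oO O0.
have Cp : C p.
  apply: contrapT => nCp; have := closed_openC cC; rewrite openE => /(_ _ nCp).
  by move=> /pacc/(_ 0%N)[n [_ [q [nCq /OC]]]].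
move: (oC); rewrite openE => /(_ _ Cp)/(nbhs_clopen_box zeroX)[U [cU Up UC]].
exists U; split=> //; apply: pacc; have [_ _ [+ _]] := cU.
by rewrite openE => /(_ _ Up).
Qed.

(** Kept as a subset of [P], insensitive to coordinate [i], so that slicing one coordinate after
    another never leaves [P]. *)
Definition slice (C : set P) i (a : X i) : set P := [set x | C (dfwith x i a)].

Lemma continuous_dfwithl i (a : X i) : continuous (fun x : P => dfwith x i a : P).
Proof.
move=> x V /(@continuous_dfwith2 I X i (x, a))[[A B] [/= xA aB] AB].
apply: filterS xA => y Ay; apply: (AB (y, a)); split=> //.
exact: nbhs_singleton aB.
Qed.

Lemma clopen_slice C i (a : X i) : clopen C -> clopen (slice C a).
Proof.
move=> cC; apply: (@preimage_clopen P P (fun x => dfwith x i a)) => //.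
exact: continuous_dfwithl.
Qed.

Lemma dfwith_eta (x : P) i : dfwith x i (x i) = x.
Proof. by apply/functional_extensionality_dep => j; case: dfwithP. Qed.

Lemma dfwith_dfwith (x : P) i (a b : X i) : dfwith (dfwith x i a) i b = dfwith x i b.
Proof.
apply/functional_extensionality_dep => j; have [<-|ij] := eqVneq i j.
  by rewrite !dfwithin.
by rewrite !dfwithout.
Qed.

Lemma dfwithC (x : P) i j (a : X i) (b : X j) : i != j ->
  dfwith (dfwith x i a) j b = dfwith (dfwith x j b) i a.
Proof.
move=> ij; apply/functional_extensionality_dep => k.
have [<-|jk] := eqVneq j k; first by rewrite dfwithin dfwithout // dfwithin.
have [<-|ik] := eqVneq i k; last by rewrite !dfwithout.
by rewrite dfwithout ?dfwithin // eq_sym.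
Qed.

Lemma box_dfwith U (x : P) i a : box U x -> U i a -> box U (dfwith x i a).
Proof. by move=> Ux Ua j; case: dfwithP. Qed.

(** The coordinates on which membership in [C] depends. Only moves out of [C] are mentioned, since a
    move into [C] can be reversed. *)
Definition essential (C : set P) : set I :=
  [set i | exists x a, C x /\ ~ C (dfwith x i a)].

Lemma essential_slice C i (a : X i) : essential (slice C a) `<=` essential C `\ i.
Proof.
move=> j [x [b [Cx nC]]]; have [ij|ij] := eqVneq i j.
  by case: nC; rewrite /slice/=; case: _ / ij b => b; rewrite dfwith_dfwith.
split; last by move=> ji; rewrite ji eqxx in ij.
exists (dfwith x i a), b; split=> //.
by rewrite dfwithC.
Qed.

(** Given infinitely many essential coordinates [k n], let [O n] be the points of [C] that can leave
    [C] through coordinate [k n]. A box in [C] meeting [O n] for arbitrarily large [n] is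
    unrestricted in coordinate [k n] once [n] is large, so such a move stays in the box, a
    contradiction. *)
Lemma finite_essential C : clopen C -> finite_set (essential C).
Proof.
move=> cC; apply: contrapT => /infinite_set_injection[k [kinj kC]].
pose O n := [set x | C x /\ exists a, ~ C (dfwith x (k n) a)].
have oO n : open (O n).
  rewrite (_ : O n = \bigcup_(a : X (k n)) (C `&` ~` slice C a)).
    apply: bigcup_open => a _; apply: openI; first by case: cC.
    by apply: closed_openC; have [] := clopen_slice a cC.
  by apply/seteqP; split=> [x [Cx [a nC]]|x [a _ [Cx nC]]]; [exists a|split=> //; exists a].
have O0 n : O n !=set0.
  have [x [a [Cx nC]]] : essential C (k n) by exact: kC.
  by exists x; split=> //; exists a.
have [U [[_ fU _] UC Uacc]] := accumulation_box cC oO O0 (fun n x => @proj1 _ _).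
have [N Nk] : exists N, forall n, (k @^-1` [set i | U i <> setT]) n -> (n < N)%N.
  apply: finite_nat_bounded; apply: finite_preimage fU => m n _ _; exact: kinj.
have [n [Nn [x [Ux [_ [a]]]]]] := Uacc N; apply; apply/UC/(box_dfwith Ux).
suff UT : U (k n) = setT by rewrite UT.
by apply: contrapT => /Nk; rewrite ltnNge Nn.
Qed.

(* Frolik's argument: otherwise there are open [O n] inside [D] and shrinking
   neighborhoods [w n] of [a] such that points of [O n] leave [D] when their
   coordinate [i] is moved into [w n.+1], whereas points of [O m] for [m > n]
   have that coordinate in [w n.+1]. A box contained in [D] that meets
   infinitely many [O n] gives a contradiction. *)
Lemma near_slab_disjoint (D : set P) i (a : X i) : clopen D ->
  (forall x, D x -> x i <> a) -> \forall b \near a, forall x, D x -> x i <> b.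
Proof.
move=> cD Da; apply: contrapT => nW.
have step W : exists OV : set P * set (X i), nbhs a W ->
    [/\ open OV.1, OV.1 !=set0, OV.1 `<=` D, forall x, OV.1 x -> W (x i) &
    [/\ nbhs a OV.2, OV.2 `<=` W &
      forall x b, OV.1 x -> OV.2 b -> ~ D (dfwith x i b)]].
  (* The dummy pair makes the step total in [W], as the choice of [F] requires. *)
  have [aW|] := pselect (nbhs a W); last by exists (set0, set0).
  have [x [Dx Wx]] : exists x, D x /\ W° (x i).
    apply: contrapT => nx; apply: nW; apply: filterS (nbhs_interior aW) => b Wb x Dx xb.
    by apply: nx; exists x; rewrite xb.
  have nDa : ~ D (dfwith x i a) by move=> /Da; rewrite dfwithin.
  have nD : nbhs (dfwith x i a : P) (~` D).
    by apply: open_nbhs_nbhs; split=> //; apply: closed_openC; case: cD.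
  have [[A B] [/= xA aB] AB] := @continuous_dfwith2 I X i (x, a) _ nD.
  exists (A° `&` D `&` (proj i @^-1` W°), B `&` W) => _ /=; split.
  - apply: openI; first by apply: openI; [exact: open_interior|case: cD].
    by apply: open_comp; [move=> ? _; exact: proj_continuous|exact: open_interior].
  - by exists x; split.
  - by move=> y [[]].
  - by move=> y [_ /interior_subset].
  - split; [exact: filterI|by move=> b []|].
    by move=> y b [[/interior_subset Ay _] _] [Bb _]; exact: (AB (y, b)).
have {step} /choice[F HF] := step.
pose w := fix w n := if n is m.+1 then (F (w m)).2 else setT.
have wa n : nbhs a (w n).
  by elim: n => [|n IH]; [exact: filterT|have [_ _ _ _ []] := HF _ IH].
have w_sub m n : (m <= n)%N -> w n `<=` w m.
  elim: n => [|n IH]; first by rewrite leqn0 => /eqP->.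
  rewrite leq_eqVlt => /predU1P[->//|/IH mn]; apply: subset_trans mn.
  by have [_ _ _ _ []] := HF _ (wa n).
pose O n := (F (w n)).1.
have [|||U [_ UD Uacc]] := @accumulation_box O D cD.
- by move=> n; have [] := HF _ (wa n).
- by move=> n; have [] := HF _ (wa n).
- by move=> n; have [] := HF _ (wa n).
(* With [x] in [O n], [y] in a later [O m] and both in [box U], moving coordinate [i] of [x] to
   [y i] stays in [box U] but leaves [D]. *)
have [n [_ [x [Ux Ox]]]] := Uacc 0%N.
have [m [nm [y [Uy Oy]]]] := Uacc n.+1.
have [_ _ _ _ [_ _]] := HF _ (wa n); move=> /(_ x (y i) Ox); apply.
  by apply: (w_sub n.+1 m nm); have [_ _ _ + _] := HF _ (wa m); apply.
by apply: UD; apply: box_dfwith.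
Qed.

(** Let [D] be the points whose membership in [C] changes when coordinate [i] is reset to [a]. None
    has coordinate [a], hence for [b] near [a] none has coordinate [b], which says that the two
    slices agree. *)
Lemma locally_constant_slice (C : set P) i (a : X i) : clopen C ->
  \forall b \near a, slice C b = slice C a.
Proof.
move=> cC.
have cS := clopen_slice a cC.
pose D := (C `&` ~` slice C a) `|` (~` C `&` slice C a).
have cD : clopen D by apply: clopenU; apply: clopenI => //; exact: clopenC.
have Da x : D x -> x i <> a.
  by move=> + xa; rewrite /D /slice/= -xa dfwith_eta; case; case.
apply: filterS (near_slab_disjoint cD Da) => b nD; apply/seteqP; split=> x Cx.
  apply: contrapT => nCx; apply: (nD (dfwith x i b)); last by rewrite dfwithin.
  by left; rewrite /slice/= dfwith_dfwith.
apply: contrapT => nCx; apply: (nD (dfwith x i b)); last by rewrite dfwithin.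
by right; rewrite /slice/= dfwith_dfwith.
Qed.

Lemma open_slice_class C i S : clopen C -> open [set a : X i | slice C a = S].
Proof.
move=> cC; rewrite openE => a <-; exact: locally_constant_slice.
Qed.

Lemma clopen_slice_class C i S : clopen C -> clopen [set a : X i | slice C a = S].
Proof.
move=> cC; split; first exact: open_slice_class.
rewrite -openC openE => a aS; apply: filterS (locally_constant_slice a cC).
by move=> b /= ->.
Qed.

(** Infinitely many slices would give infinitely many nonempty open classes in [X i]. Their
    preimages in [P] are locally finite: near [p] the slice is constant, so at most one class is
    met. *)
Lemma finite_slices (x0 : P) C i : clopen C -> finite_set (range (@slice C i)).
Proof.
move=> cC; apply: contrapT => /infinite_set_injection[k [kinj kC]].
apply: (@not_lf (fun n => @proj I X i @^-1` [set a | slice C a = k n])) => [n|n|p].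
- apply: open_comp.
    by move=> ? _; exact: proj_continuous.
  exact: open_slice_class.
- have [a _ ak] := kC n.
  by exists (dfwith x0 i a); rewrite /= /proj dfwithin.
have near_p : \forall q \near p, slice C (q i) = slice C (p i).
  exact: (@proj_continuous I X i p _ (locally_constant_slice (p i) cC)).
have [[m pm]|npk] := pselect (exists m, slice C (p i) = k m).
  exists m.+1; apply: filterS near_p => q qp n mn; rewrite /= /proj qp pm => /kinj mn'.
  by rewrite mn' ltnn in mn.
exists 0%N; apply: filterS near_p => q qp n _ pn; apply: npk; exists n.
by rewrite -qp.
Qed.

End pseudocompact_product.

(** * Finite disjoint unions of copies *)

Definition empty_or_copy (T : topologicalType) (A : set T) :=
  A = set0 \/ homeo_sets A [set: T].

Lemma empty_or_copyU (T : topologicalType) (S A B : set T) : clopen S ->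
  homeo_sets S [set: T] -> homeo_sets (~` S) [set: T] ->
  open A -> open B -> A `&` B = set0 ->
  empty_or_copy A -> empty_or_copy B -> empty_or_copy (A `|` B).
Proof.
move=> cS ST SCT oA oB AB0 [->|AT]; first by rewrite set0U.
move=> [->|BT]; [by right; rewrite setU0|right].
have bigcup_bool (U V : set T) : U `|` V = \bigcup_(b : bool) if b then U else V.
  apply/seteqP; split=> [x [Ux|Vx]|x [[] _ ?]]; [by exists true|by exists false|by left|by right].
have trivI (U V : set T) : U `&` V = set0 -> trivIset [set: bool] (fun b => if b then U else V).
  move=> UV0 [] [] _ _ [x []] // Ux Vx; suff : set0 x by [].
    by rewrite -UV0.
  by rewrite -UV0.
rewrite -(setUv S) !bigcup_bool; apply: homeo_sets_bigcup.
- by case.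
- by case; [case: cS|apply: closed_openC; case: cS].
- exact: trivI.
- by apply: trivI; rewrite setICr.
- by case; [apply: homeo_sets_trans AT _|apply: homeo_sets_trans BT _];
    exact: homeo_sets_sym.
Qed.

Lemma empty_or_copy_bigcup (T : topologicalType) (K : Type) (S : set T)
    (D : set K) (F : K -> set T) :
  clopen S -> homeo_sets S [set: T] -> homeo_sets (~` S) [set: T] ->
  finite_set D -> (forall k, open (F k)) -> trivIset setT F ->
  (forall k, D k -> empty_or_copy (F k)) -> empty_or_copy (\bigcup_(k in D) F k).
Proof.
move=> cS ST SCT fD oF tF; elim/Pchoice: K => K in D F fD oF tF *.
move: fD => /finite_seqP[s ->]; elim: s => [|k s IH] eF.
  by left; rewrite set_nil bigcup_set0.
have {}IH : empty_or_copy (\bigcup_(j in [set` s]) F j).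
  by apply: IH => j /= js; apply: eF; rewrite /= inE js orbT.
have -> : [set` k :: s] = k |` [set` s].
  by apply/seteqP; split=> j /=; rewrite inE => /predU1P.
rewrite bigcup_setU1.
(* The enumerating list may repeat an index, which adds nothing to the union. *)
have [ks|/negP ks] := boolP (k \in s).
  by rewrite (setUidr (bigcup_sup (i := k) (P := [set` s]) ks)).
apply: empty_or_copyU cS ST SCT _ _ _ _ IH => //.
- exact: bigcup_open.
- apply/seteqP; split=> // x [Fk [j /= js Fj]].
  by apply: ks; rewrite (tF k j) //; exists x.
- by apply: eF; rewrite /= inE eqxx.
Qed.

(** * Decomposition into boxes and conclusion *)

Section product.
Context {I : eqType} (X : I -> topologicalType).
Local Notation P := (prod_topology X).
Hypothesis zeroX : forall i : I, zero_dimensional_space (X i).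
Hypothesis homX : forall i : I, h_homogeneous (X i).

(** A box around a point [y] outside [C] restricts finitely many coordinates. Changing those of a
    point [x] of [C] to the values of [y], one by one, never leaves [C] yet ends in the box. *)
Lemma inessential_trivial (C : set P) : open C -> open (~` C) ->
  essential C = set0 -> C = set0 \/ C = setT.
Proof.
move=> oC oCC eC; have [|/set0P[x Cx]] := eqVneq C set0; first by left.
right; apply/seteqP; split=> // y _; apply: contrapT => nCy.
move: oCC; rewrite openE => /(_ _ nCy)/(nbhs_clopen_box zeroX)[U [[_ fU _] Uy UC]].
move: fU => /finite_seqP[s sU].
pose z (t : seq I) : P := foldr (fun i (w : P) => dfwith w i (y i)) x t.
have Cz t : C (z t).
  elim: t => //= i t IH; apply: contrapT => nC.
  by have : essential C i by [exists (z t), (y i)]; rewrite eC.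
apply: (UC (z s)) (Cz s) => i.
have zE t : i \in t -> z t i = y i.
  elim: t => //= j t IH; rewrite inE.
  have [<-|ij] := eqVneq j i; first by rewrite dfwithin.
  by rewrite /= dfwithout.
have [/zE ->//|/negP nis] := boolP (i \in s).
suff -> : U i = setT by [].
by apply: contrapT => Ui; apply: nis; have : [set i | U i <> setT] i by []; rewrite sU.
Qed.

Section pseudocompact.
Hypothesis not_lf : forall O : nat -> set P,
  (forall n, open (O n)) -> (forall n, O n !=set0) -> ~ locally_finite_seq O.
Variable S : set P.
Hypotheses (cS : clopen S) (ST : homeo_sets S [set: P])
  (SCT : homeo_sets (~` S) [set: P]).

(** Induction on [s]. Where coordinate [i] lies in the slice class of [a], [C] coincides with
    [slice C a], for which [i] is inessential. The class is clopen, so it is absorbed into the box;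
    this is why a box is carried along. *)
Lemma empty_or_copy_boxI (x0 : P) (s : seq I) (C : set P) U :
  clopen C -> essential C `<=` [set` s] -> clopen_box U ->
  empty_or_copy (box U `&` C).
Proof.
elim: s C U => [|i s IH] C U cC eC cU.
  have [|||->|->] := @inessential_trivial C.
  - by case: cC.
  - by apply: closed_openC; case: cC.
  - by apply/seteqP; split=> // i /eC.
  - by left; rewrite setI0.
  rewrite setIT; have [->|/set0P U0] := eqVneq (box U) set0; first by left.
  by right; apply: homeo_sets_box => //; case: cU.
pose F (Q : set P) := 
  box U `&` C `&` proj i @^-1` [set a | slice C a = Q].
have -> : box U `&` C = \bigcup_(Q in range (@slice I X C i)) F Q.
  apply/seteqP; split=> [x UCx|x [Q _ []]//].
  by exists (slice C (x i)); [exists (x i)|split].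
apply: (empty_or_copy_bigcup cS ST SCT).
- exact: finite_slices.
- move=> Q; apply: openI; first by apply: openI; [case: cU => _ _ []|case: cC].
  apply: open_comp.
    by move=> ? _; exact: proj_continuous.
  exact: open_slice_class.
- by move=> Q Q' _ _ [x [[_ <-] [_ <-]]].
move=> _ [a _ <-]; pose V j := U j `&` 
  cylinder [set b : X i | slice C b = slice C a] (j := j).
have -> : F (slice C a) = box V `&` slice C a.
  rewrite boxI box_cylinder; apply/seteqP; split=> x.
    by move=> [[Ux Cx] /= Ca]; split=> //; rewrite -Ca /slice/= dfwith_eta.
  by move=> [[Ux /= Ca]]; rewrite -Ca /slice/= dfwith_eta.
apply: IH; first exact: clopen_slice.
  move=> j /(@essential_slice _ X)[/eC /=]; rewrite inE => /predU1P[->|//].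
  by case.
by apply: clopen_boxI => //; apply: clopen_cylinder; exact: clopen_slice_class.
Qed.

End pseudocompact.

Hypothesis hausX : forall i, hausdorff_space (X i).

Lemma clopen_homeo_setsT (C : set P) : clopen C -> C !=set0 ->
  homeo_sets C [set: P].
Proof.
move=> cC C0; have [x0 Cx0] := C0.
have [[G [oG G0 lG]]|nO] := pselect (exists O : nat -> set P,
    [/\ forall n, open (O n), forall n, O n !=set0 & locally_finite_seq O]).
  apply: homeo_sets_locally_finite oG G0 lG cC C0 => W oW [x Wx].
  move: oW; rewrite openE => /(_ _ Wx)/(nbhs_clopen_box zeroX)[U [cU Ux UW]].
  have [cUi _ cbU] := cU; exists (box U) => //; split=> //.
  by apply: homeo_sets_box => //; exists x.
have not_lf (O : nat -> set P) : (forall n, open (O n)) ->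
    (forall n, O n !=set0) -> ~ locally_finite_seq O.
  by move=> oO O0 lO; apply: nO; exists O.
(* A proper nonempty clopen subset of one factor splits [P] into two cylinders, each a copy of
   [P]. *)
have [[i [A [cA [a Aa] [b nAb]]]]|conn] := pselect (exists i (A : set (X i)),
    [/\ clopen A, A !=set0 & ~` A !=set0]).
  have cyl (B : set (X i)) : clopen B -> B !=set0 ->
      homeo_sets (box (cylinder B)) [set: P].
    move=> cB [c Bc]; apply: homeo_sets_box => //.
      by case: (clopen_cylinder cB).
    by exists (dfwith x0 i c); rewrite box_cylinder /= dfwithin.
  have cS : clopen (box (cylinder A)) by case: (clopen_cylinder cA).
  have ST := cyl A cA (ex_intro _ a Aa).
  have SCT : homeo_sets (~` box (cylinder A)) [set: P].
    rewrite [~` _](_ : _ = box (cylinder (~` A))); last by rewrite !box_cylinder.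
    by apply: cyl; [exact: clopenC|exists b].
  have /finite_seqP[s es] := finite_essential zeroX not_lf cC.
  have [||UC0|] := @empty_or_copy_boxI not_lf _ cS ST SCT x0 s C (fun=> setT) cC.
  - by rewrite es.
  - exact: clopen_boxT.
  - by have : (box (fun=> setT) `&` C) x0 by []; rewrite UC0.
  - by rewrite (_ : box _ = setT) ?setTI //; apply/seteqP; split.
(* Otherwise each factor is a single point, being Hausdorff with a clopen base, and [P] consists of
   [x0] alone. *)
rewrite (_ : C = setT); first exact: homeo_sets_refl.
apply/seteqP; split=> // x _; suff -> : x = x0 by [].
apply/functional_extensionality_dep => i; apply: contrapT => xi.
have nx : nbhs (x i) (~` [set x0 i]).
  apply: open_nbhs_nbhs; split=> //; apply: closed_openC.
  exact/accessible_closed_set1/hausdorff_accessible.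
have [B [_ Bx] Bc] := zeroX i; have [A /= [BA Ax] AV] := Bx _ _ nx.
apply: conn; exists i, A; split; [exact: Bc|by exists (x i)|exists (x0 i)].
by move=> /AV; apply.
Qed.

End product.

Theorem corollary14 (I : Type) (X : I -> topologicalType)
  (tychX : forall i : I, tychonoff_space (X i))
  (homX : forall i : I, h_homogeneous (X i))
  (zeroX : forall i : I, zero_dimensional_space (X i)) :
  h_homogeneous (prod_topology X).
Proof.
move=> A B cA cB A0 B0; apply: homeo_sets_set_type.
have copy (C : set (prod_topology X)) : clopen C -> C !=set0 ->
    homeo_sets C [set: prod_topology X].
  (* [{classic I}] equips [I] with the decidable equality needed to modify single coordinates. *)
  apply: (@clopen_homeo_setsT {classic I} X zeroX homX) => i.
  by case: (tychX i).
by apply: homeo_sets_trans (copy A cA A0) _; apply/homeo_sets_sym/copy.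
Qed.
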